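(* For every real $d\ge 3\ln 3$, \[\chi(\mathbb{H}^2,\{d\})\le 4\left\lceil\frac{d}{\ln 3}\right\rceil+4.\]
   Context: $\mathbb{H}^2$ is the hyperbolic plane of constant curvature $-1$ with its hyperbolic distance. $\chi(\mathbb{H}^2,\{d\})$ is the chromatic number of the graph with vertex set $\mathbb{H}^2$ in which two points are adjacent iff their hyperbolic distance equals $d$. *)

(* Defs.v *)
From HB Require Import structures.
From mathcomp Require Import all_boot all_order all_algebra.
From mathcomp Require Import all_classical all_reals all_analysis.

Set Implicit Arguments.
Unset Strict Implicit.
Unset Printing Implicit Defensive.

Import Order.TTheory GRing.Theory Num.Theory.
Import numFieldNormedType.Exports.

Local Open Scope classical_set_scope.
Local Open Scope ring_scope.

Definition arcosh (R : realType) (x : R) : R := ln (x + Num.sqrt (x ^+ 2 - 1)).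

Lemma arcoshK (R : realType) (x : R) :
  1 <= x -> (expR (arcosh x) + expR (- arcosh x)) / 2 = x.
Proof.
move=> x1; have x0 : 0 < x by exact: lt_le_trans x1.
have s0 : 0 <= x ^+ 2 - 1 by rewrite subr_ge0 exprn_ege1.
have p0 : 0 < x + Num.sqrt (x ^+ 2 - 1) by rewrite ltr_pwDl// sqrtr_ge0.
rewrite expRN /arcosh lnK ?posrE//.
have -> : (x + Num.sqrt (x ^+ 2 - 1))^-1 = x - Num.sqrt (x ^+ 2 - 1).
  apply: (mulfI (lt0r_neq0 p0)); rewrite mulfV ?lt0r_neq0//.
  by rewrite mulrC -subr_sqr sqr_sqrtr// opprB addrC subrK.
by rewrite addrACA subrr addr0 -mulr2n -[x *+ 2]mulr_natr mulfK// pnatr_eq0.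
Qed.

(* The hyperbolic plane, in the Poincare half-plane model: the points
   re + i im with im > 0, with the metric of curvature -1, whose distance is
   given by  cosh (hdist z w) = 1 + |z - w|^2 / (2 Im z Im w). *)
Record hyperbolic_plane (R : realType) := HPoint {
  hre : R;
  him : R;
  him_gt0 : 0 < him
}.

Definition hdist (R : realType) (z w : hyperbolic_plane R) : R :=
  arcosh (1 + ((hre z - hre w) ^+ 2 + (him z - him w) ^+ 2)
              / (2 * him z * him w)).

(* Graphs may be infinite: they are given by an adjacency relation on a type. *)
Definition colorable (T : Type) (adj : T -> T -> Prop) (k : nat) : Prop :=
  exists c : T -> 'I_k, forall x y, adj x y -> c x <> c y.

(* The least k such that the graph is k-colorable, and +oo if there is none. *)
Definition chromatic_number (R : realType) (T : Type) (adj : T -> T -> Prop) :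
    \bar R :=
  ereal_inf [set k%:R%:E | k in colorable adj].

Definition distance_adj (R : realType) (T : Type) (dist : T -> T -> R)
    (D : set R) (x y : T) : Prop := D (dist x y).

Definition hyperbolic_chromatic_number (R : realType) (D : set R) : \bar R :=
  chromatic_number R (distance_adj (@hdist R) D).

(* Main.v *)
(* The horizontal strips 3^j <= y < 3^(j+1) have height ln 3; colouring them
   periodically with period k + 1, where k = ceil (d / ln 3), keeps distinct
   strips of the same colour more than d apart.  If two points of the strip j
   are at distance d, then |x - x'| lies in [3^j r, 3^(j+1) r) where
   r = 2 sinh (d / 2), so cutting the strip into vertical pieces of Euclidean
   width 3^j r and repeating four colours along it separates them. *)
Require Import Defs.
From mathcomp Require Import all_boot all_order all_algebra.
From mathcomp Require Import all_classical all_reals all_analysis.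
From mathcomp Require Import zify ring lra.
Set Implicit Arguments.
Unset Strict Implicit.
Unset Printing Implicit Defensive.
Import Order.TTheory GRing.Theory Num.Theory.
Local Open Scope classical_set_scope.
Local Open Scope ring_scope.

Lemma colorable_card (T : Type) (adj : T -> T -> Prop) (F : finType)
    (c : T -> F) :
  (forall x y, adj x y -> c x <> c y) -> colorable adj #|F|.
Proof.
move=> adjc; exists (fun x => enum_rank (c x)) => x y /adjc cxy.
by move=> /enum_rank_inj.
Qed.

Lemma chromatic_number_le (R : realType) (T : Type) (adj : T -> T -> Prop)
    (k : nat) :
  colorable adj k -> (chromatic_number R adj <= k%:R%:E)%E.
Proof. by move=> adjk; apply: ereal_inf_lbound; exists k. Qed.

(** The remainder modulo [m.+1] lies between 0 and [m] for negative [i] as well, so [inord] never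
    takes its default value. *)
Definition residue (m : nat) (i : int) : 'I_m.+1 := inord `|(i %% m.+1)%Z|%N.

Lemma residue_inj (m : nat) (i j : int) :
  residue m i = residue m j -> `|i - j| < m.+1%:Z -> i = j.
Proof.
move=> /(congr1 val) /=; have m0 : 0 < m.+1%:Z by [].
have [i0 j0] := (modz_ge0 i (lt0r_neq0 m0), modz_ge0 j (lt0r_neq0 m0)).
have [im jm] := (ltz_pmod i m0, ltz_pmod j m0).
rewrite !inordK; [|lia..] => ij.
have {}ij : (i %% m.+1)%Z = (j %% m.+1)%Z by lia.
rewrite (divz_eq i m.+1) (divz_eq j m.+1) ij.
rewrite opprD addrACA subrr addr0 -mulrBl normrM (gtr0_norm m0) -[ltRHS]mul1r ltr_pM2r// => q.
by have -> : (i %/ m.+1)%Z = (j %/ m.+1)%Z by lia.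
Qed.

(** Multiplied by [r], the hypothesis reads [(r - x) ^+ 2 <= x ^+ 2 - 1], which bounds [r - x] by
    the square root. *)
Lemma ln_le_arcosh (R : realType) (r x : R) :
  0 < r -> r + r^-1 <= 2 * x -> ln r <= arcosh x.
Proof.
move=> r0 rx; have rV0 : 0 < r^-1 by rewrite invr_gt0.
have rrV : r * r^-1 = 1 by rewrite mulfV ?gt_eqF.
have rle : r <= x + Num.sqrt (x ^+ 2 - 1).
  rewrite -lerBlDl (le_trans (ler_norm _))// -sqrtr_sqr ler_wsqrtr//.
  nra.
by rewrite ler_ln ?posrE// (lt_le_trans r0).
Qed.

Lemma cosh_hdist (R : realType) (z w : hyperbolic_plane R) :
  (expR (hdist z w) + expR (- hdist z w)) / 2 =
  1 + ((hre z - hre w) ^+ 2 + (him z - him w) ^+ 2) / (2 * him z * him w).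
Proof.
rewrite arcoshK// lerDl divr_ge0 ?addr_ge0 ?sqr_ge0//.
by rewrite !mulr_ge0// ltW// him_gt0.
Qed.

Lemma hdistC (R : realType) (z w : hyperbolic_plane R) : hdist z w = hdist w z.
Proof.
by rewrite /hdist -sqrrN opprB -[(him z - _) ^+ 2]sqrrN opprB mulrAC.
Qed.

Lemma hdist_ge_ln_him (R : realType) (z w : hyperbolic_plane R) :
  `|ln (him z) - ln (him w)| <= hdist z w.
Proof.
wlog suff le_ln : z w / ln (him z) - ln (him w) <= hdist z w.
  by rewrite ler_norml le_ln andbT lerNl opprB hdistC le_ln.
have [z0 w0] := (him_gt0 z, him_gt0 w).
rewrite -ln_div ?posrE//; apply: ln_le_arcosh; first by rewrite divr_gt0.
(* For [r = him z / him w], twice the cosh of the distance exceeds [r + r^-1] by exactly the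
   horizontal contribution. *)
rewrite -subr_ge0; set e := (X in 0 <= X).
have -> : e = (hre z - hre w) ^+ 2 / (him z * him w).
  by rewrite /e; field; rewrite !gt_eqF.
by rewrite divr_ge0 ?sqr_ge0// mulr_ge0 ?ltW.
Qed.

Definition cell (R : realType) (u x : R) : int := Num.floor (x / u).

Lemma cell_bounds (R : realType) (u x : R) :
  0 < u -> (cell u x)%:~R * u <= x < ((cell u x)%:~R + 1) * u.
Proof.
move=> u0; rewrite -ler_pdivlMr// -ltr_pdivrMr//.
by rewrite floor_le_tmp -[1]/(1%:~R) -intrD floorD1_gt.
Qed.

Definition strip (R : realType) (z : hyperbolic_plane R) : int :=
  cell (ln 3) (ln (him z)).

(** This is 3 to the power [j], written with [expR] since [j] may be negative. *)
Definition strip_base (R : realType) (j : int) : R := expR (j%:~R * ln 3).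

Lemma ln3_gt0 (R : realType) : 0 < ln 3 :> R.
Proof. by rewrite ln_gt0// ltr1n. Qed.

Lemma strip_ln (R : realType) (z : hyperbolic_plane R) :
  (strip z)%:~R * ln 3 <= ln (him z) < ((strip z)%:~R + 1) * ln 3.
Proof. exact/cell_bounds/ln3_gt0. Qed.

Lemma strip_him (R : realType) (z : hyperbolic_plane R) :
  strip_base R (strip z) <= him z < 3 * strip_base R (strip z).
Proof.
have := strip_ln z; rewrite -ler_expR -ltr_expR lnK ?posrE ?him_gt0//.
by rewrite mulrDl mul1r expRD [expR (ln 3)]lnK ?posrE// [_ * 3]mulrC.
Qed.

(** Heights on the logarithmic scale differ by at most [k * ln 3], and half-open strips add strictly
    less than one index. *)
Lemma strip_near (R : realType) (z w : hyperbolic_plane R) (k : nat) :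
  hdist z w <= k%:R * ln 3 -> `|strip z - strip w| < k.+1%:Z.
Proof.
move=> dk; have := le_trans (hdist_ge_ln_him z w) dk.
rewrite ler_norml => /andP[lo hi].
have [/andP[z1 z2] /andP[w1 w2]] := (strip_ln z, strip_ln w).
have l3 := ln3_gt0 R.
rewrite ltr_norml -!(ltr_int R) !rmorphN/= intrB -addn1 PoszD intrD.
have -> : k%:~R = k%:R :> R by [].
by apply/andP; split; rewrite -(ltr_pM2r l3); nra.
Qed.

(** With heights [a] and [b], the distance formula gives [W * (a * b) - (a - b) ^+ 2] for the
    squared horizontal gap. Dropping the square yields the upper bound; [2 <= W] and [b <= 3 * a]
    (for [a <= b]) yield the lower one. *)
Lemma hre_dist_in_strip (R : realType) (z w : hyperbolic_plane R) (s : R) :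
  0 < s -> s <= him z < 3 * s -> s <= him w < 3 * s ->
  let W := expR (hdist z w) + expR (- hdist z w) - 2 in 2 <= W ->
  W * s ^+ 2 <= (hre z - hre w) ^+ 2 < W * (3 * s) ^+ 2.
Proof.
move=> s0 zs ws W W2.
have WE : (hre z - hre w) ^+ 2 =
    W * (him z * him w) - (him z - him w) ^+ 2.
  have /(canRL (mulfVK _)) := cosh_hdist z w.
  rewrite pnatr_eq0 => /(_ isT) WE; rewrite /W WE; field.
  by rewrite !gt_eqF ?him_gt0.
rewrite {}WE; move: (him z) (him w) zs ws => a b.
wlog ab : a b / a <= b => [th za zb|/andP[a1 a2] /andP[b1 b2]].
  have [/th|/ltW/th] := leP a b; first exact.
  by rewrite -(sqrrN (a - b)) opprB [a * b]mulrC; apply.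
have {}ab : 0 <= b - a by rewrite subr_ge0.
apply/andP; split.
  (* The three nonnegative terms [h1], [h2], [h3] add up to exactly
     [W * (a * b) - (a - b) ^+ 2 - W * s ^+ 2]. *)
  have h1 : 0 <= (W - 2) * (a * (b - a)).
    by rewrite !mulr_ge0 //; lra.
  have h2 : 0 <= (b - a) * (3 * a - b) by rewrite mulr_ge0//; lra.
  have h3 : 0 <= W * ((a - s) * (a + s)) by rewrite !mulr_ge0//; lra.
  lra.
have h : a * b < (3 * s) ^+ 2 by rewrite expr2 ltr_pM//; lra.
have : W * (a * b) < W * (3 * s) ^+ 2 by rewrite ltr_pM2l//; lra.
by have := sqr_ge0 (a - b); lra.
Qed.

(** Points less than [m.+1] widths apart have cell indices differing by less than [m.+2], the number
    of colours, so equal residues force a common cell. *)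
Lemma residue_cell (R : realType) (u x y : R) (m : nat) :
  0 < u -> residue m.+1 (cell u x) = residue m.+1 (cell u y) ->
  `|x - y| < m.+1%:R * u -> `|x - y| < u.
Proof.
move=> u0 rxy xy.
have [/andP[x1 x2] /andP[y1 y2]] := (cell_bounds x u0, cell_bounds y u0).
suff cxy : cell u x = cell u y.
  by rewrite cxy in x1 x2; rewrite ltr_norml; apply/andP; split; lra.
apply: residue_inj rxy _; move: xy; rewrite ltr_norml => /andP[lo hi].
rewrite ltr_norml -!(ltr_int R) !rmorphN/= intrB.
have -> : m.+2%:~R = m.+1%:R + 1 :> R by rewrite -[_%:~R]natr1.
by apply/andP; split; rewrite -(ltr_pM2r u0); lra.
Qed.

Theorem theorem2p1 (R : realType) (d : R) (hd : 3 * ln 3 <= d) :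
  (hyperbolic_chromatic_number [set d]
    <= (4 * Num.ceil (d / ln 3) + 4)%:~R%:E)%E.
Proof.
have l3 := ln3_gt0 R.
have d0 : 0 <= d by apply: le_trans hd; rewrite mulr_ge0 ?ltW.
have [k kE] : exists k : nat, Num.ceil (d / ln 3) = k.
  exists `|Num.ceil (d / ln 3)|%N; rewrite gez0_abs// ceil_ge0.
  by rewrite (lt_le_trans (ltrN10 R))// divr_ge0// ltW.
have dk : d <= k%:R * ln 3.
  by rewrite -ler_pdivrMr// -[k%:R]/((k : int)%:~R) -kE ceil_ge.
(* [W] is the square of [2 sinh (d / 2)]. *)
pose W := expR d + expR (- d) - 2.
have W2 : 2 <= W.
  have : 27 <= expR d.
    have -> : 27 = expR (3 * ln 3) :> R.
      by rewrite expRM_natl lnK ?posrE//; lra.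
    by rewrite ler_expR.
  by have := expR_ge0 (- d); rewrite /W; lra.
have W0 : 0 < W by lra.
(* The width depends on [z] only through its strip, so points of one strip share the same cells. *)
pose u (z : hyperbolic_plane R) : R := Num.sqrt W * strip_base R (strip z).
pose c (z : hyperbolic_plane R) :=
  (residue k (strip z), residue 3 (cell (u z) (hre z))).
have -> : (4 * Num.ceil (d / ln 3) + 4)%:~R = (#|{: 'I_k.+1 * 'I_4}|)%:R :> R.
  by rewrite kE card_prod !card_ord [RHS]pmulrn; congr (_%:~R); lia.
apply/chromatic_number_le/(@colorable_card _ _ _ c) => z w zwd [].
rewrite /distance_adj/= in zwd.
move=> /residue_inj; rewrite strip_near ?zwd// => /(_ isT) zw.
have s0 : 0 < strip_base R (strip w) by exact: expR_gt0.
have u0 : 0 < u w by rewrite mulr_gt0 ?sqrtr_gt0.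
rewrite {1}/u zw -/(u w) => /(residue_cell u0).
have zs := strip_him z; rewrite zw in zs.
(* Square roots turn these bounds into a gap of at least [u w] and less than [3 * u w]; the latter
   and equal colours modulo 4 force a gap below [u w], a contradiction. *)
have := hre_dist_in_strip s0 zs (strip_him w).
rewrite zwd => /(_ W2); rewrite -/W -(sqr_sqrtr (ltW W0)) -!exprMn.
rewrite [_ * (3 * _)]mulrCA -/(u w) -[(hre z - _) ^+ 2]real_normK ?num_real//.
rewrite ler_sqr ?ltr_sqr ?nnegrE ?mulr_ge0 ?(ltW u0) ?(ltW s0)// => /andP[lo hi].
by move=> /(_ hi); rewrite ltNge lo.
Qed.
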